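(* Let $k$ be an algebraically closed field of characteristic $p>0$ and let $\mathcal{E}$ be an elementary abelian group scheme over $k$ of abelian unipotent rank $2$. If $M$ is a finite-dimensional $\mathcal{E}$-module of constant rank, then \[ \deg(M)=\dim_k M/\mathfrak{K}(M),\] where $\mathfrak{K}(M)$ is the generic kernel of $M$ and $\deg(M)=\deg^1(M)$ is the $1$-degree of $M$.
   Context: $k\mathcal{E}=k[\mathcal{E}]^\ast$ is the algebra of measures; $\mathcal{E}$-modules are $k\mathcal{E}$-modules; for $u\in k\mathcal{E}$, $u_M$ denotes the operator $m\mapsto um$. An abelian finite group scheme $\mathcal{E}$ is elementary abelian if it is a product $\mathcal{E}=\mathcal{E}_1\cdots\mathcal{E}_n$ of subgroups, each isomorphic to a Frobenius kernel $\mathbb{G}_{a(r_i)}$ of the additive group or to the constant group $\mathbb{Z}/(p)$. Then $k\mathcal{E}\cong k[X_1,\ldots,X_n]/(X_1^p,\ldots,X_n^p)$ as an algebra for a unique $n$, which is the abelian unipotent rank of $\mathcal{E}$. Let $\mathfrak{A}_p=k[T]/(T^p)$, $t=T+(T^p)$. As $\mathcal{E}$ is abelian unipotent, a $p$-point of $\mathcal{E}$ is an algebra homomorphism $\alpha:\mathfrak{A}_p\to k\mathcal{E}$ making $k\mathcal{E}$ a projective $\mathfrak{A}_p$-module; via $\alpha\mapsto\alpha(t)$ these correspond to the elements of $\mathrm{Rad}(k\mathcal{E})\setminus\mathrm{Rad}^2(k\mathcal{E})$. $M$ has constant rank $d$ if $\mathrm{rk}(\alpha(t)_M)=d$ for all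 $p$-points $\alpha$. $M$ has the equal images property if for every $\ell\in\{1,\ldots,p-1\}$ there is a subspace $V_\ell\subseteq M$ with $\mathrm{im}\,\alpha(t)_M^\ell=V_\ell$ for all $p$-points $\alpha$. The class of equal images modules is closed under images and direct sums, so every $M$ has a unique largest submodule with the equal images property, the generic kernel $\mathfrak{K}(M)$. Degree of a morphism: if $U\subseteq\mathbb{P}^n$ is non-empty open and $\varphi:U\to\mathbb{P}^m$ is a morphism, there are homogeneous polynomials $f_0,\ldots,f_m$ of the same degree $d$ with $\gcd(f_0,\ldots,f_m)=1$ and $\varphi(x)=(f_0(x):\cdots:f_m(x))$ for all $x\in U$; they are unique up to a common non-zero scalar, and $\deg(\varphi):=d$. Degree of a module of constant rank $d$: let $U_{\mathcal{E}}=\{[u]\in\mathbb{P}(\mathrm{Rad}(k\mathcal{E})) : u\notin\mathrm{Rad}^2(k\mathcal{E})\}$, a dense open subset of the projective space $\mathbb{P}(\mathrm{Rad}(k\mathcal{E}))$, and let $\mathrm{Im}_M:U_{\mathcal{E}}\to\mathrm{Gr}_d(M)$, $[u]\mapsto\mathrm{im}(u_M)$, a morphism to the Grassmannian of $d$-dimensional subspaces. Then $\deg(M):=\deg(\mathrm{pl}_M\circ\mathrm{Im}_M)$ with $\mathrm{pl}_M:\mathrm{Gr}_d(M)\to\mathbb{P}(\bigwedge^d M)$ the Plücker embedding ($\deg(M)=0$ if $d=0$). *)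

(* Defs.v *)
From HB Require Import structures.
From mathcomp Require Import all_boot all_order all_algebra all_field.
From mathcomp Require Import mpoly.
From Stdlib Require Import ClassicalEpsilon.

Set Implicit Arguments.
Unset Strict Implicit.
Unset Printing Implicit Defensive.

Import GRing.Theory.
Local Open Scope ring_scope.

(* A formal sum [:: (a1, b1); ...; (an, bn)] stands for the element
   a1 (x) b1 + ... + an (x) bn of A (x) B. Two formal sums are the same tensor
   iff all products of linear forms agree on them, because such products
   separate the points of a tensor product of vector spaces. *)
Definition teq (k : fieldType) (A B : vectType k) (s t : seq (A * B)) : Prop :=
  forall (mu : 'Hom(A, k^o)) (nu : 'Hom(B, k^o)),
    \sum_(x <- s) mu x.1 * nu x.2 = \sum_(x <- t) mu x.1 * nu x.2.

(* A finite group scheme over k, given by its coordinate ring k[E]: a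
   finite-dimensional commutative Hopf algebra. *)
Record finGroupScheme (k : fieldType) := FinGroupScheme {
  coordRing :> falgType k;
  coordRingC : commutative (@GRing.mul coordRing);
  comul : coordRing -> seq (coordRing * coordRing);
  counit : {lrmorphism coordRing -> k^o};
  antipode : {linear coordRing -> coordRing};
  comulP : forall c a b,
    teq (comul (c *: a + b)) ([seq (c *: x.1, x.2) | x <- comul a] ++ comul b);
  comul1 : teq (comul 1) [:: (1, 1)];
  comulM : forall a b, teq (comul (a * b))
    [seq (x.1 * y.1, x.2 * y.2) | x <- comul a, y <- comul b];
  comulA : forall a (mu nu rho : 'Hom(coordRing, k^o)),
    \sum_(x <- comul a) \sum_(y <- comul x.2) mu x.1 * (nu y.1 * rho y.2) =
    \sum_(x <- comul a) \sum_(y <- comul x.1) mu y.1 * nu y.2 * rho x.2;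
  counitl : forall a, \sum_(x <- comul a) counit x.1 *: x.2 = a;
  counitr : forall a, \sum_(x <- comul a) counit x.2 *: x.1 = a;
  antipodel : forall a, \sum_(x <- comul a) antipode x.1 * x.2 = (counit a)%:A;
  antipoder : forall a, \sum_(x <- comul a) x.1 * antipode x.2 = (counit a)%:A
}.

Definition abelian_scheme (k : fieldType) (E : finGroupScheme k) : Prop :=
  forall a : E, teq (comul a) [seq (x.2, x.1) | x <- comul a].

(* The algebra of measures kE = k[E]^*: its product is the convolution
   (mu nu)(a) = (mu (x) nu)(Delta a), its unit is the counit of k[E]. *)
Definition measures (k : fieldType) (E : finGroupScheme k) : Type :=
  'Hom(E, k^o).

HB.instance Definition _ (k : fieldType) (E : finGroupScheme k) :=
  Vector.on (measures E).

Section MeasureAlgebra.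
Variables (k : fieldType) (E : finGroupScheme k).
Implicit Types (mu nu rho : 'Hom(E, k^o)) (a b : E).

Definition conv_fun mu nu (a : E) : k^o := \sum_(x <- comul a) mu x.1 * nu x.2.

Fact conv_fun_linear mu nu : linear (conv_fun mu nu).
Proof.
move=> c a b; rewrite /conv_fun comulP big_cat big_map /= scaler_sumr.
by congr (_ + _); apply: eq_bigr => x _; rewrite linearZ /= scalerAl.
Qed.

HB.instance Definition _ mu nu :=
  GRing.isLinear.Build k E k^o _ (conv_fun mu nu) (conv_fun_linear mu nu).

Definition conv mu nu : 'Hom(E, k^o) := linfun (conv_fun mu nu).
Definition conv1 : 'Hom(E, k^o) := linfun (counit E).

Lemma convE mu nu a : conv mu nu a = \sum_(x <- comul a) mu x.1 * nu x.2.
Proof. by rewrite lfunE. Qed.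

Fact convA : associative (conv : measures E -> measures E -> measures E).
Proof.
move=> mu nu rho; apply/lfunP => a; rewrite !convE.
under eq_bigr => x _ do rewrite convE mulr_sumr.
by rewrite comulA; apply: eq_bigr => x _; rewrite convE mulr_suml.
Qed.

Fact conv1l : left_id (conv1 : measures E) conv.
Proof.
move=> mu; apply/lfunP => a; rewrite convE -{2}[a]counitl linear_sum.
by apply: eq_bigr => x _; rewrite linearZ lfunE.
Qed.

Fact conv1r : right_id (conv1 : measures E) conv.
Proof.
move=> mu; apply/lfunP => a; rewrite convE -{2}[a]counitr linear_sum.
by apply: eq_bigr => x _; rewrite linearZ lfunE /= mulrC.
Qed.

Fact convDl :
  left_distributive (conv : measures E -> measures E -> measures E) +%R.
Proof.
move=> mu nu rho; apply/lfunP => a; rewrite add_lfunE !convE -big_split /=.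
by apply: eq_bigr => x _; rewrite add_lfunE mulrDl.
Qed.

Fact convDr :
  right_distributive (conv : measures E -> measures E -> measures E) +%R.
Proof.
move=> mu nu rho; apply/lfunP => a; rewrite add_lfunE !convE -big_split /=.
by apply: eq_bigr => x _; rewrite add_lfunE mulrDr.
Qed.

Fact conv1_neq0 : (conv1 : measures E) != 0.
Proof.
apply/eqP => /lfunP/(_ 1); rewrite lfunE /= rmorph1 zero_lfunE => /eqP.
by rewrite oner_eq0.
Qed.

HB.instance Definition _ := GRing.Zmodule_isNzRing.Build (measures E)
  convA conv1l conv1r convDl convDr conv1_neq0.

Fact convZl (c : k) (mu nu : measures E) : c *: (mu * nu) = (c *: mu) * nu.
Proof.
apply/lfunP => a; rewrite scale_lfunE !convE scaler_sumr.
by apply: eq_bigr => x _; rewrite scale_lfunE scalerAl.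
Qed.

HB.instance Definition _ :=
  GRing.Lmodule_isLalgebra.Build k (measures E) convZl.

Fact convZr (c : k) (mu nu : measures E) : c *: (mu * nu) = mu * (c *: nu).
Proof.
apply/lfunP => a; rewrite scale_lfunE !convE scaler_sumr.
by apply: eq_bigr => x _; rewrite scale_lfunE scalerAr.
Qed.

HB.instance Definition _ :=
  GRing.Lalgebra_isAlgebra.Build k (measures E) convZr.
HB.instance Definition _ := Algebra_isFalgebra.Build k (measures E).

End MeasureAlgebra.

(* A closed embedding of group schemes F -> E is a surjective homomorphism
   k[E] -> k[F] of Hopf algebras. (Counit and antipode are preserved by every
   bialgebra homomorphism.) *)
Definition closed_embedding (k : fieldType) (E F : finGroupScheme k)
    (f : {lrmorphism E -> F}) : Prop :=
  (forall b : F, exists a : E, f a = b) /\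
  (forall a : E, teq (comul (f a)) [seq (f x.1, f x.2) | x <- comul a]).

(* The image of kF -> kE, mu |-> mu o f, for the comorphism f of F -> E. *)
Definition measures_sub (k : fieldType) (E F : finGroupScheme k)
    (f : {lrmorphism E -> F}) : {vspace measures E} :=
  limg (linfun
    (fun mu : measures F => ((mu : 'Hom(F, k^o)) \o linfun f)%VF : measures E)).

(* G_a(r): k[F] = k[T]/(T^(p^r)) with T primitive. *)
Definition is_Ga_kernel (k : fieldType) (p r : nat) (F : finGroupScheme k) :
    Prop :=
  exists f : {lrmorphism {poly %/ ('X^(p ^ r) : {poly k})} -> F},
    bijective f /\
    teq (comul (f 'qX)) [:: (f 'qX, 1); (1, f 'qX)].

(* The constant group Z/(p): k[F] = k^(Z/(p)), with e g the indicator
   function of g. *)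
Definition is_constant_Zp (k : fieldType) (p : nat) (F : finGroupScheme k) :
    Prop :=
  exists e : 'Z_p -> F,
    [/\ basis_of fullv [seq e g | g : 'Z_p],
        \sum_g e g = 1,
        forall g h, e g * e h = if g == h then e g else 0
      & forall g, teq (comul (e g)) [seq (e h, e (g - h)) | h : 'Z_p]].

(* E = E_1 ... E_n means that the multiplication E_1 x ... x E_n -> E is a
   quotient map, i.e. that k[E] -> k[E_1] (x) ... (x) k[E_n] is injective;
   dually, kE is spanned by the products of elements of kE_1, ..., kE_n. *)
Definition elementary_abelian (k : fieldType) (p : nat)
    (E : finGroupScheme k) : Prop :=
  abelian_scheme E /\
  exists (n : nat) (F : 'I_n -> finGroupScheme k)
      (f : forall i, {lrmorphism E -> F i}),
    [/\ forall i, closed_embedding (f i),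
        forall i, (exists2 r, (0 < r)%N & is_Ga_kernel p r (F i)) \/
                  is_constant_Zp p (F i)
      & \big[@prodv _ _/1%VS]_(i < n) measures_sub (f i) = fullv].

(* kE is isomorphic, as a k-algebra, to k[X_1, ..., X_n]/(X_1^p, ..., X_n^p). *)
Definition abelian_unipotent_rank (k : fieldType) (p : nat)
    (E : finGroupScheme k) (n : nat) : Prop :=
  exists f : {lrmorphism {mpoly k[n]} -> measures E},
    (forall u : measures E, exists q, f q = u) /\
    (forall q, f q = 0 <->
       exists h : 'I_n -> {mpoly k[n]}, q = \sum_(i < n) h i * 'X_i ^+ p).

Lemma largest_vspace (k : fieldType) (V : vectType k)
    (P : {vspace V} -> Prop) :
  P 0%VS -> (forall U W, P U -> P W -> P (U + W)%VS) ->
  exists K, P K /\ forall U, P U -> (U <= K)%VS.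
Proof.
move=> P0 PD.
suff H m K : P K -> (\dim {:V} - \dim K <= m)%N ->
    exists K, P K /\ forall U, P U -> (U <= K)%VS.
  exact: (H _ _ P0 (leqnn _)).
elim: m K => [|m IH] K PK leKm.
  exists K; split=> // U _; suff /eqP -> : K == fullv by rewrite subvf.
  by rewrite eqEdim subvf -subn_eq0 -leqn0.
case: (excluded_middle_informative (forall U, P U -> (U <= K)%VS)) => [maxK|].
  by exists K.
move=> /not_all_ex_not[U nU]; have [PU nUK] := imply_to_and _ _ nU.
apply: (IH (K + U)%VS); first exact: PD.
have ltKU : (\dim K < \dim (K + U))%N.
  rewrite ltn_neqAle dimvS ?addvSl // andbT; apply/eqP => eqd; apply: nUK.
  have /eqP -> : K == (K + U)%VS by rewrite eqEdim addvSl eqd /=.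
  exact: addvSr.
by rewrite -ltnS; apply: leq_trans leKm; rewrite ltn_sub2l // (leq_trans ltKU) ?dimvS ?subvf.
Qed.

Definition left_ideal (k : fieldType) (H : falgType k) (I : {vspace H}) : Prop :=
  (fullv * I <= I)%VS.

Definition maximal_left_ideal (k : fieldType) (H : falgType k)
    (I : {vspace H}) : Prop :=
  [/\ left_ideal I, I <> fullv
    & forall J : {vspace H}, left_ideal J -> (I <= J)%VS -> J = I \/ J = fullv].

Lemma Rad_subproof (k : fieldType) (H : falgType k) :
  exists J : {vspace H},
    forall u, u \in J <-> forall I, maximal_left_ideal I -> u \in I.
Proof.
have [||J [PJ maxJ]] := @largest_vspace k H
    (fun U => forall I, maximal_left_ideal I -> (U <= I)%VS).
- by move=> I _; rewrite sub0v.
- by move=> U W PU PW I mI; rewrite subv_add PU ?PW.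
exists J => u; split=> [Ju I /PJ/subvP|uI]; first exact.
by rewrite memvE; apply: maxJ => I /uI; rewrite memvE.
Qed.

(* The Jacobson radical, i.e. the intersection of all maximal left ideals. *)
Definition Rad (k : fieldType) (H : falgType k) : {vspace H} :=
  proj1_sig (constructive_indefinite_description _ (Rad_subproof H)).


Definition projective (R : nzRingType) (P : lmodType R) : Prop :=
  forall (N N' : lmodType R) (g : {linear N -> N'}) (f : {linear P -> N'}),
    (forall y, exists x, g x = y) ->
    exists h : {linear P -> N}, forall x, g (h x) = f x.

(* The ring S viewed as a left R-module via a : R -> S. *)
Definition restr_scalars (R S : nzRingType) (a : {rmorphism R -> S}) : Type := S.

Section RestrScalars.
Variables (R S : nzRingType) (a : {rmorphism R -> S}).

HB.instance Definition _ := GRing.Zmodule.on (restr_scalars a).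

Definition restr_scale (r : R) (x : restr_scalars a) : restr_scalars a :=
  a r * (x : S).

Fact restr_scaleA r s x : restr_scale r (restr_scale s x) = restr_scale (r * s) x.
Proof. by rewrite /restr_scale rmorphM mulrA. Qed.

Fact restr_scale1 : left_id 1 restr_scale.
Proof. by move=> x; rewrite /restr_scale rmorph1 mul1r. Qed.

Fact restr_scaleDr : right_distributive restr_scale +%R.
Proof. by move=> r x y; rewrite /restr_scale mulrDr. Qed.

Fact restr_scaleDl x : {morph restr_scale^~ x : r s / r + s}.
Proof. by move=> r s; rewrite /restr_scale rmorphD mulrDl. Qed.

HB.instance Definition _ := GRing.Zmodule_isLmodule.Build R (restr_scalars a)
  restr_scaleA restr_scale1 restr_scaleDr restr_scaleDl.

End RestrScalars.

(* k[T]/(T^p), with t = 'qX. *)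
Notation truncated k p := {poly %/ ('X^p : {poly k})}.

Definition p_point (k : fieldType) (p : nat) (E : finGroupScheme k)
    (alpha : {lrmorphism truncated k p -> measures E}) : Prop :=
  projective (restr_scalars alpha).

Record schemeModule (k : fieldType) (E : finGroupScheme k) := SchemeModule {
  module_space :> vectType k;
  act : {linear measures E -> 'End(module_space)};
  act1 : act 1 = \1%VF;
  actM : forall u v, act (u * v) = (act u \o act v)%VF
}.

Definition constant_rank (k : fieldType) (p : nat) (E : finGroupScheme k)
    (M : schemeModule E) (d : nat) : Prop :=
  forall alpha : {lrmorphism truncated k p -> measures E},
    p_point alpha -> \dim (limg (act M (alpha 'qX))) = d.

Definition submodule (k : fieldType) (E : finGroupScheme k)
    (M : schemeModule E) (N : {vspace M}) : Prop :=
  forall u, (act M u @: N <= N)%VS.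

Definition equal_images (k : fieldType) (p : nat) (E : finGroupScheme k)
    (M : schemeModule E) (N : {vspace M}) : Prop :=
  forall l : nat, (0 < l < p)%N ->
    exists V : {vspace M},
      forall alpha : {lrmorphism truncated k p -> measures E},
        p_point alpha -> (act M (alpha 'qX ^+ l) @: N)%VS = V.

Lemma generic_kernel_subproof (k : fieldType) (p : nat) (E : finGroupScheme k)
    (M : schemeModule E) :
  exists K : {vspace M},
    (submodule K /\ equal_images p K) /\
    forall N : {vspace M}, submodule N /\ equal_images p N -> (N <= K)%VS.
Proof.
apply: (@largest_vspace k M (fun N => submodule N /\ equal_images p N)).
  split=> [u|l _]; first by rewrite limg0 sub0v.
  by exists 0%VS => alpha _; rewrite limg0.
move=> U W [sU eU] [sW eW]; split=> [u|l lp].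
  by rewrite limgD addvS ?sU ?sW.
have [V1 h1] := eU l lp; have [V2 h2] := eW l lp.
by exists (V1 + V2)%VS => alpha pa; rewrite limgD h1 ?h2.
Qed.

(* The largest submodule with the equal images property. *)
Definition generic_kernel (k : fieldType) (p : nat) (E : finGroupScheme k)
    (M : schemeModule E) : {vspace M} :=
  proj1_sig (constructive_indefinite_description _
    (generic_kernel_subproof p M)).

Definition no_common_factor (k : fieldType) (n : nat) (I : finType)
    (f : I -> {mpoly k[n]}) : Prop :=
  forall g, (forall i, exists h, f i = g * h) -> g \is a GRing.unit.

(* D is the degree of a morphism phi from an open subset of projective space
   to projective space, given in homogeneous coordinates: U is the cone over
   the domain (without the origin), and phi x y says that y is a homogeneous
   coordinate vector of the image of [x]. *)
Definition morphism_degree (k : fieldType) (n : nat) (I : finType)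
    (U : 'rV[k]_n -> Prop) (phi : 'rV[k]_n -> (I -> k) -> Prop) (D : nat) :
    Prop :=
  exists f : I -> {mpoly k[n]},
    [/\ forall i, f i \is D.-homog,
        no_common_factor f
      & forall x, U x -> phi x (fun i => (f i).@[fun j => x 0 j])].

(* Strictly increasing d-tuples, indexing the standard basis of the d-th
   exterior power of an m-dimensional space. *)
Definition increasing (d m : nat) : finType :=
  {s : {ffun 'I_d -> 'I_m} |
    [forall i : 'I_d, forall j : 'I_d, (i < j)%N ==> (s i < s j)%N]}.

(* y is a vector of homogeneous coordinates of the Pluecker point
   [b_1 /\ ... /\ b_d] of the d-dimensional subspace W with basis b. *)
Definition plucker (k : fieldType) (M : vectType k) (d : nat)
    (W : {vspace M}) (y : increasing d (\dim {:M}) -> k) : Prop :=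
  exists (b : d.-tuple M) (c : k),
    [/\ basis_of W b, c != 0
      & forall s, y s =
          c * \det (\matrix_(i, j) coord (vbasis {:M}) (val s j) (tnth b i))].

(* D is the degree of M, a module of constant rank d. The morphism im_M is
   expressed in the coordinates of Rad (kE) given by the basis vbasis. *)
Definition module_degree (k : fieldType) (E : finGroupScheme k)
    (M : schemeModule E) (d D : nat) : Prop :=
  let R := Rad (measures E) in
  let elt (x : 'rV[k]_(\dim R)) := \sum_i x 0 i *: (vbasis R)`_i in
  morphism_degree (fun x => elt x \notin (R * R)%VS)
    (fun x (y : increasing d (\dim {:M}) -> k) =>
       plucker (limg (act M (elt x))) y) D.

(* Main.v *)
Require Import Defs.
From HB Require Import structures.
From mathcomp Require Import all_boot all_order all_algebra all_field.
From mathcomp Require Import mpoly zify.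
From Stdlib Require Import ClassicalEpsilon.

Set Implicit Arguments.
Unset Strict Implicit.
Unset Printing Implicit Defensive.

Import GRing.Theory passmx.
Local Open Scope ring_scope.

(* Write kE = k[x, y]/(x^p, y^p), R for its radical and U = R \ R^2, the set of
   the values alpha(t) of the p-points. If f, g is a pencil of operators of
   constant rank, the sum N of the kernels of its members satisfies
   im (a f + b g)|_N = im f|_N for all (a, b) <> 0. Applied to the action of x
   and y, this makes N an equal images module; hence the generic kernel K
   contains the kernel of every u in U, and W = u K does not depend on u. So
   im u is spanned by a basis of W and the vectors u c_1, ..., u c_D, where
   c_1, ..., c_D is a basis of a complement of K, and the Pluecker coordinates of
   im u are homogeneous of degree D = dim M/K in u and have no common zero on U.
   They have no common factor since U contains a projective line, and
   comparing with any other representation on that line shows that the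
   degree is unique. *)

(** * Pencils of constant rank *)

(** Take [t = - a^-1] with [a] nonzero and not an eigenvalue of [h]: a kernel vector of [1 + t h]
    would be an eigenvector for [a]. Such an [a] exists because ['X * char_poly A] has a
    non-root. *)
Lemma exists_id_add_scale_inj (k : closedFieldType) (M : vectType k)
    (h : 'End(M)) :
  exists2 t : k, t != 0 & lker (\1%VF + t *: h) == 0%VS.
Proof.
pose A := mxof (vbasis {:M}) (vbasis {:M}) h.
have nzp : 'X * char_poly A != 0 :> {poly k}.
  by rewrite mulf_neq0 ?polyX_eq0 ?monic_neq0 ?char_poly_monic.
have /closed_nonrootP [a] := nzp.
rewrite rootM negb_or -{1}['X]subr0 root_XsubC => /andP[a0].
rewrite -eigenvalue_root_char => aA.
have a0' : - a^-1 != 0 by rewrite oppr_eq0 invr_eq0.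
exists (- a^-1) => //.
move: aA; rewrite negbK -(vsof_eq0 (vbasisP {:M})) -leigenspaceE ?vbasisP //.
move=> /eqP e0; rewrite -subv0; apply/subvP => v.
rewrite memv_ker add_lfunE id_lfunE scale_lfunE scaleNr subr_eq0 => /eqP ev.
rewrite -e0 memv_ker add_lfunE opp_lfunE scale_lfunE id_lfunE {2}ev scalerA divff //.
by rewrite scale1r subrr.
Qed.

Lemma dim_lker (k : fieldType) (aT rT : vectType k) (f : 'Hom(aT, rT)) :
  \dim (lker f) = (\dim {:aT} - \dim (limg f))%N.
Proof. by rewrite -(limg_ker_dim f fullv) capfv addnK. Qed.

(* The kernels of [c f + g] alone already span a space [N] containing the kernel
   of [f]: on [N] the image of [f + t g] lies in that of [f], with equality for
   generic [t], so constancy of the rank forces [f] to have a kernel in [N] of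
   the maximal possible dimension. *)
Lemma constant_rank_pencil (k : closedFieldType) (M : vectType k)
    (f g : 'End(M)) (d : nat) :
  (forall a b, (a != 0) || (b != 0) -> \dim (limg (a *: f + b *: g)) = d) ->
  exists s : seq k, let N := (\sum_(c <- s) lker (c *: f + g)%R)%VS in
    (g @: N <= f @: N)%VS /\ (lker f <= N)%VS.
Proof.
move=> rk.
(* Finite dimension lets a finite sum of kernels absorb the kernel of every [c f + g]. *)
have [||N [[s defN] maxN]] := @largest_vspace k M
    (fun N => exists s : seq k, N = (\sum_(c <- s) lker (c *: f + g)%R)%VS).
- by exists [::]; rewrite big_nil.
- by move=> _ _ [s ->] [t ->]; exists (s ++ t); rewrite big_cat.
exists s; rewrite -defN /=.
(* On the kernel of [c f + g] the operator [g] equals [- c f]. *)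
have gf : (g @: N <= f @: N)%VS.
  rewrite {1}defN limg_sum big_seq_cond.
  apply: (big_ind (fun U => U <= f @: N)%VS) => [|U V hU hV|c].
  - exact: sub0v.
  - by rewrite subv_add hU.
  rewrite andbT => cs; apply/subvP => _ /memv_imgP[v + ->].
  move=> vK; have vN : v \in N.
    rewrite defN (big_rem _ cs) /=; apply: subvP vK; exact: addvSl.
  move: vK; rewrite memv_ker add_lfunE scale_lfunE addrC addr_eq0 => /eqP->.
  by rewrite -scaleNr -linearZ memv_img // memvZ.
split=> //.
have kerN c : (lker (c *: f + g)%R <= N)%VS.
  by apply: maxN; exists [:: c]; rewrite big_seq1.
pose f' := (f \o projv N)%VF; pose sec := (projv N \o f'^-1)%VF.
have imf' : limg f' = (f @: N)%VS by rewrite limg_comp limg_proj.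
have secK w : w \in (f @: N)%VS -> f (sec w) = w.
  by rewrite -imf' => w_im; rewrite -{2}(limg_lfunVK w_im) !comp_lfunE.
have secN w : sec w \in N by rewrite comp_lfunE memv_proj.
(* On [f @: N] the map [1 + t (g \o sec)] is [(f + t g) \o sec], where [sec] inverts [f] with values
   in [N]. Its injectivity shows that [f + t g] has at least the rank of [f] on [N]. *)
have [t t0 inj] := exists_id_add_scale_inj (g \o sec)%VF.
have le1 : (\dim (f @: N) <= \dim ((f + t *: g)%R @: N))%N.
  rewrite -(limg_dim_eq (f := (\1 + t *: (g \o sec))%VF) (U := (f @: N)%VS)).
    apply/dimvS/subvP => _ /memv_imgP[w wN ->].
    suff -> : (\1 + t *: (g \o sec))%VF w = (f + t *: g)%VF (sec w).
      exact: memv_img.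
    by rewrite !add_lfunE !scale_lfunE id_lfunE secK // comp_lfunE.
  by move/eqP: inj => ->; rewrite capv0.
have ker1 : lker (f + t *: g) = lker (t^-1 *: f + g).
  apply/vspaceP => v; rewrite !memv_ker !add_lfunE !scale_lfunE.
  have -> : f v + t *: g v = t *: (t^-1 *: f v + g v).
    by rewrite scalerDr scalerA divff // scale1r.
  by rewrite scaler_eq0 (negPf t0).
have kdim : \dim (lker (f + t *: g)) = \dim (lker f).
  have := rk 1 t; have := rk 1 0; rewrite oner_eq0 !scale1r scale0r addr0.
  by rewrite !dim_lker => -> // ->.
(* Rank-nullity on [N] for both operators: the whole kernel of [f + t g] lies in [N], so
   [N :&: lker f] is at least as large as that kernel, which has the dimension of [lker f]. *)
have := limg_ker_dim (f + t *: g) N.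
have /capv_idPr -> : (lker (f + t *: g)%R <= N)%VS by rewrite ker1.
have := limg_ker_dim f N; rewrite kdim => <- e.
have le2 : (\dim (lker f) <= \dim (N :&: lker f))%N.
  by rewrite -(leq_add2r (\dim (f @: N))) -e leq_add2l.
suff /eqP <- : (N :&: lker f == lker f)%VS by rewrite capvSl.
by rewrite eqEdim capvSr le2.
Qed.

(** * Flat points of truncated polynomial algebras *)

Section Truncated.
Variables (k : fieldType) (p : nat).
Hypothesis p_gt0 : (0 < p)%N.
Notation B := (truncated k p).

(** [mk_monic] keeps its argument only if it is monic and non-constant, whence [0 < p]. *)
Lemma mk_monic_Xp : mk_monic ('X^p : {poly k}) = 'X^p.
Proof. by rewrite mk_monic_Xn prednK. Qed.

Lemma in_qpolyK (c : B) : in_qpoly 'X^p (c : {poly k}) = c.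
Proof. by apply/val_inj/in_qpoly_small/size_mk_monic. Qed.

Lemma in_qpoly_eq0 (q : {poly k}) : in_qpoly 'X^p q = 0 <-> 'X^p %| q.
Proof.
have E : val (in_qpoly 'X^p q) = q %% 'X^p.
  by rewrite Pdiv.IdomainMonic.modpE ?monicXn //= mk_monic_Xp.
by rewrite /dvdp -E; split=> [->|/eqP e] //; apply/val_inj.
Qed.

Lemma qXn n : ('qX : B) ^+ n = in_qpoly 'X^p 'X^n.
Proof. by rewrite rmorphXn. Qed.

Lemma qXp : ('qX : B) ^+ p = 0.
Proof. by rewrite qXn; apply/in_qpoly_eq0. Qed.

Lemma qX_ann (c : B) : 'qX * c = 0 -> exists b, c = 'qX ^+ p.-1 * b.
Proof.
rewrite -[c in _ * c]in_qpolyK -[_ * _]rmorphM /= => /in_qpoly_eq0.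
have eX : 'X^p = 'X * 'X^(p.-1) :> {poly k} by rewrite -exprS prednK.
rewrite {1}eX dvdp_mul2l ?polyX_eq0 // => /dvdpP[q eq].
by exists (in_qpoly 'X^p q); rewrite qXn -rmorphM /= mulrC -eq in_qpolyK.
Qed.

Lemma qpoly_sum (c : B) : c = \sum_(i < p) (c : {poly k})`_i *: 'qX ^+ i.
Proof.
have sz : (size (c : {poly k}) <= p)%N.
  have szX : size (mk_monic ('X^p : {poly k})) = p.+1.
    by rewrite mk_monic_Xp size_polyXn.
  by rewrite -ltnS -szX size_mk_monic.
have -> : \sum_(i < p) (c : {poly k})`_i *: ('qX : B) ^+ i =
    in_qpoly 'X^p (\poly_(i < p) (c : {poly k})`_i).
  rewrite poly_def linear_sum.
  by apply: eq_bigr => i _; rewrite linearZ qXn.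
rewrite -[LHS]in_qpolyK; congr in_qpoly; apply/polyP => i; rewrite coef_poly.
by case: ltnP => // le_pi; rewrite nth_default // (leq_trans sz).
Qed.

Section Point.
Variables (A : falgType k) (u : A).

(** The proof argument makes the morphism structures below attach to this map, since evaluation at
    [u] factors through the quotient only when [u ^+ p = 0]. *)
Definition point_hom (_ : u ^+ p = 0) (c : B) : A := horner_alg u (c : {poly k}).

Hypothesis up : u ^+ p = 0.

Lemma horner_alg_in_qpoly q :
  horner_alg u (in_qpoly 'X^p q : {poly k}) = horner_alg u q.
Proof.
rewrite [in RHS](divp_eq q 'X^p) rmorphD rmorphM rmorphXn /= horner_algX up.
by rewrite mulr0 add0r Pdiv.IdomainMonic.modpE ?monicXn // mk_monic_Xp.
Qed.

Lemma point_hom_linear : linear (point_hom up).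
Proof. by move=> a c d; rewrite /point_hom linearP /= mulr_algl. Qed.

Lemma point_hom_monoid : monoid_morphism (point_hom up).
Proof.
split=> [|c d]; first by rewrite /point_hom -in_qpoly1 horner_alg_in_qpoly rmorph1.
rewrite /point_hom -[c * d]/(in_qpoly 'X^p ((c : {poly k}) * (d : {poly k}))).
by rewrite horner_alg_in_qpoly rmorphM.
Qed.

HB.instance Definition _ := GRing.isLinear.Build k B A _ (point_hom up)
  point_hom_linear.
HB.instance Definition _ := GRing.isMonoidMorphism.Build B A (point_hom up)
  point_hom_monoid.

Lemma point_hom_qX : point_hom up 'qX = u.
Proof. by rewrite /point_hom horner_alg_in_qpoly horner_algX. Qed.

End Point.

Lemma exists_point_hom (A : falgType k) (u : A) :
  u ^+ p = 0 -> exists alpha : {lrmorphism B -> A}, alpha 'qX = u.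
Proof.
move=> up; exists (point_hom up : {lrmorphism B -> A}); exact: point_hom_qX.
Qed.

Lemma lrmorph_qpoly (A : falgType k) (alpha : {lrmorphism B -> A}) (c : B) :
  alpha c = \sum_(i < p) (c : {poly k})`_i *: alpha 'qX ^+ i.
Proof.
rewrite [in LHS](qpoly_sum c) linear_sum.
by apply: eq_bigr => i _; rewrite linearZ rmorphXn.
Qed.

Lemma restr_scalarsE (A : falgType k) (alpha : {lrmorphism B -> A}) (c : B)
    (a : restr_scalars alpha) : c *: a = alpha c * (a : A).
Proof. by []. Qed.

(** Projectivity splits a surjection from a free module [B^n] onto [A]. In [B^n] the claim holds
    coordinatewise by [qX_ann], and the surjection carries it back to [A]. *)
Lemma projective_ann (A : falgType k) (alpha : {lrmorphism B -> A}) z :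
  projective (restr_scalars alpha) -> alpha 'qX * z = 0 ->
  exists b, z = alpha 'qX ^+ p.-1 * b.
Proof.
move=> proj tz0; pose n := \dim {:A}; pose e i : restr_scalars alpha := (vbasis {:A})`_i.
pose g (r : 'rV[B]_n) : restr_scalars alpha := \sum_i r 0 i *: e i.
have g_lin : linear g.
  move=> a r s; rewrite /g scaler_sumr -big_split; apply: eq_bigr => i _.
  by rewrite !mxE scalerDl scalerA.
pose G : {linear 'rV[B]_n -> restr_scalars alpha} :=
  HB.pack g (GRing.isLinear.Build B 'rV[B]_n (restr_scalars alpha) _ g g_lin).
have [|h hK] := proj _ _ G (idfun : {linear restr_scalars alpha -> restr_scalars alpha}).
  move=> a; exists (\row_i (coord (vbasis {:A}) i a)%:A).
  rewrite /= /g [RHS](coord_vbasis (memvf (a : A))).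
  by apply: eq_bigr => i _; rewrite mxE restr_scalarsE linearZ rmorph1 mulr_algl.
have hz0 : 'qX *: h z = 0 by rewrite -linearZ -[RHS](linear0 h); congr (h _).
have /fin_all_exists[b hb] i : exists b, h z 0 i = 'qX ^+ p.-1 * b.
  by apply: qX_ann; have := congr1 (fun r : 'rV_n => r 0 i) hz0; rewrite !mxE.
exists (g (\row_i b i)); rewrite -[LHS](hK z) -rmorphXn.
have -> : h z = 'qX ^+ p.-1 *: \row_i b i by apply/rowP => i; rewrite !mxE hb.
by rewrite linearZ.
Qed.

(** The hypotheses say that the powers of [w] below [p] form a basis of [A] over [k[T]/(T^p)], so
    [A] is free and a lift may be chosen on that basis. *)
Lemma projective_of_basis (A : falgType k) (alpha : {lrmorphism B -> A}) (w : A) :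
  (forall c : 'I_p -> 'I_p -> k,
     \sum_i \sum_j c i j *: (alpha 'qX ^+ i * w ^+ j) = 0 -> forall i j, c i j = 0) ->
  (forall a, exists c : 'I_p -> 'I_p -> k,
     a = \sum_i \sum_j c i j *: (alpha 'qX ^+ i * w ^+ j)) ->
  projective (restr_scalars alpha).
Proof.
move=> indep span N N' g f g_surj.
pose e (j : 'I_p) : restr_scalars alpha := w ^+ j.
pose Phi (c : 'I_p -> B) : restr_scalars alpha := \sum_j c j *: e j.
have PhiE c : Phi c =
    \sum_(i < p) \sum_(j < p) (c j : {poly k})`_i *: (alpha 'qX ^+ i * w ^+ j) :> A.
  rewrite exchange_big; apply: eq_bigr => j _.
  rewrite restr_scalarsE lrmorph_qpoly mulr_suml.
  by apply: eq_bigr => i _; rewrite scalerAl.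
have Phi_inj c : Phi c = 0 -> forall j, c j = 0.
  rewrite PhiE => /indep c0 j; rewrite (qpoly_sum (c j)) big1 // => i _.
  by rewrite c0 scale0r.
have Phi_surj a : exists c, Phi c = a.
  have [c ->] := span a.
  exists (fun j => \sum_i c i j *: 'qX ^+ i); rewrite exchange_big.
  apply: eq_bigr => j _; rewrite restr_scalarsE linear_sum mulr_suml.
  by apply: eq_bigr => i _; rewrite linearZ rmorphXn scalerAl.
pose Psi a := proj1_sig (constructive_indefinite_description _ (Phi_surj a)).
have PsiK a : Phi (Psi a) = a by rewrite /Psi; case: constructive_indefinite_description.
(* The coordinates [Psi] come from a choice; uniqueness, that is [Phi_inj], makes them linear. *)
have Psi_lin b a a' j : Psi (b *: a + a') j = b * Psi a j + Psi a' j.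
  apply/eqP; rewrite -subr_eq0; apply/eqP.
  apply: (Phi_inj (fun j => Psi (b *: a + a') j - (b * Psi a j + Psi a' j))).
  have -> : 0 = Phi (Psi (b *: a + a')) - (b *: Phi (Psi a) + Phi (Psi a')).
    by rewrite !PsiK subrr.
  rewrite /Phi scaler_sumr -big_split -sumrB; apply: eq_bigr => i _.
  by rewrite scalerBl scalerDl scalerA.
have /fin_all_exists[n gn] j : exists n, g n = f (e j) by exact: g_surj.
pose h a : N := \sum_j Psi a j *: n j.
have h_lin : linear h.
  move=> b a a'; rewrite /h scaler_sumr -big_split; apply: eq_bigr => j _.
  by rewrite Psi_lin scalerDl scalerA.
pose H : {linear restr_scalars alpha -> N} :=
  HB.pack h (GRing.isLinear.Build B (restr_scalars alpha) N _ h h_lin).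
exists H => a; rewrite -[a in RHS]PsiK /= /h /Phi !linear_sum.
by apply: eq_bigr => j _; rewrite !linearZ /= gn.
Qed.

End Truncated.

Lemma mem_Rad (k : fieldType) (H : falgType k) (u : H) :
  u \in Rad H <-> forall I, maximal_left_ideal I -> u \in I.
Proof.
by rewrite /Rad; case: constructive_indefinite_description => J /= ->.
Qed.

Lemma indep_family_span (k : fieldType) (V : vectType k) (I : finType)
    (F : I -> V) :
  (forall c : I -> k, \sum_i c i *: F i = 0 -> forall i, c i = 0) ->
  (\dim {:V} <= #|I|)%N ->
  forall v, exists c : I -> k, v = \sum_i c i *: F i.
Proof.
move=> indep le_dim v.
pose X := [tuple F (enum_val i) | i < #|I|].
have XE (i : 'I_#|I|) : X`_i = F (enum_val i) by rewrite -tnth_nth tnth_mktuple.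
have sumE (c : 'I_#|I| -> k) :
    \sum_i c i *: X`_i = \sum_i c (enum_rank i) *: F i.
  rewrite [RHS](reindex (@enum_val _ I)) /=; last exact/onW_bij/enum_val_bij.
  by apply: eq_bigr => i _; rewrite XE enum_valK.
have freeX : free X.
  apply/freeP => c; rewrite sumE => /indep e i.
  by have := e (enum_val i); rewrite enum_valK.
have basX : basis_of fullv X by rewrite basisEfree freeX subvf size_tuple.
exists (fun i => coord X (enum_rank i) v).
by rewrite -(sumE (fun i => coord X i v)) -(coord_basis basX (memvf v)).
Qed.

(** * The local algebra k[x, y]/(x^p, y^p) and the powers of its radical *)

Section TruncatedAlgebra.
Variables (k : fieldType) (p : nat) (A : falgType k) (x y : A).
Hypothesis mulC : commutative (@GRing.mul A).
Hypothesis p_gt1 : (1 < p)%N.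
Hypotheses (xp0 : x ^+ p = 0) (yp0 : y ^+ p = 0).
Hypothesis xy_neq0 : x ^+ p.-1 * y ^+ p.-1 != 0.

(* The n-th power of the ideal (x, y). *)
Definition fil (n : nat) : {vspace A} :=
  (\sum_(ij : 'I_p * 'I_p | (n <= ij.1 + ij.2)%N) <[x ^+ ij.1 * y ^+ ij.2]>)%VS.

Hypothesis spanA : fil 0 = fullv.

Lemma mulCA a b c : a * (b * c) = b * (a * c) :> A.
Proof. by rewrite mulrA (mulC a) -mulrA. Qed.

Lemma mulACA a b c d : a * b * (c * d) = a * c * (b * d) :> A.
Proof. by rewrite -!mulrA (mulCA b). Qed.

Lemma exprM_comm (a b : A) n : (a * b) ^+ n = a ^+ n * b ^+ n.
Proof. exact/exprMn_comm/mulC. Qed.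

Lemma expr_ge_eq0 (a : A) n m : a ^+ n = 0 -> (n <= m)%N -> a ^+ m = 0.
Proof. by move=> an0 le_nm; rewrite -(subnK le_nm) exprD an0 mulr0. Qed.

Lemma monomial_fil i j n : (n <= i + j)%N -> x ^+ i * y ^+ j \in fil n.
Proof.
move=> le_n; have [lt_ip|le_pi] := ltnP i p; last first.
  by rewrite (expr_ge_eq0 xp0) // mul0r mem0v.
have [lt_jp|le_pj] := ltnP j p; last first.
  by rewrite (expr_ge_eq0 yp0) // mulr0 mem0v.
by rewrite memvE /fil (bigD1 (Ordinal lt_ip, Ordinal lt_jp)) //= addvSl.
Qed.

Lemma fil_sub n (U : {vspace A}) :
  (forall i j, (n <= i + j)%N -> x ^+ i * y ^+ j \in U) -> (fil n <= U)%VS.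
Proof. by move=> hU; apply/subv_sumP => ij /hU; rewrite memvE. Qed.

Lemma fil_mul n m a b : a \in fil n -> b \in fil m -> a * b \in fil (n + m).
Proof.
move=> an bm.
suff /subvP/(_ _ an) : (fil n <= amulr b @^-1: fil (n + m))%VS.
  by rewrite -memv_preim lfunE.
apply: fil_sub => i j le_n; rewrite -memv_preim lfunE /=.
suff /subvP/(_ _ bm) : (fil m <= amull (x ^+ i * y ^+ j) @^-1: fil (n + m))%VS.
  by rewrite -memv_preim lfunE.
apply: fil_sub => i' j' le_m; rewrite -memv_preim lfunE /=.
by rewrite mulACA -!exprD monomial_fil //; lia.
Qed.

Lemma filS n m : (m <= n)%N -> (fil n <= fil m)%VS.
Proof. by move=> le_mn; apply: fil_sub => i j le_n; apply: monomial_fil; lia. Qed.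

(** Both exponents stay below [p], so the top monomial has degree 2p - 2. *)
Lemma fil_eq0 n : (p.*2.-1 <= n)%N -> fil n = 0%VS.
Proof.
move=> le_n; rewrite /fil big_pred0 // => -[i j] /=.
by have := ltn_ord i; have := ltn_ord j; lia.
Qed.

Lemma fil_mulr n a b : a \in fil n -> a * b \in fil n.
Proof. by move=> an; rewrite -[n]addn0 fil_mul // spanA memvf. Qed.

Lemma fil_mull n a b : a \in fil n -> b * a \in fil n.
Proof. by rewrite mulC; apply: fil_mulr. Qed.

Lemma fil_exp n a m : a \in fil n -> a ^+ m \in fil (n * m).
Proof.
move=> an; elim: m => [|m IH]; first by rewrite muln0 spanA memvf.
by rewrite exprS mulnS fil_mul.
Qed.

Lemma x_fil1 : x \in fil 1.
Proof. by have := @monomial_fil 1 0 1; rewrite expr1 expr0 mulr1; apply. Qed.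

Lemma y_fil1 : y \in fil 1.
Proof. by have := @monomial_fil 0 1 1; rewrite expr1 expr0 mul1r; apply. Qed.

Lemma fil1_ideal a : a \in fil 1 -> exists b c, a = x * b + y * c.
Proof.
have /subvP sub : (fil 1 <= limg (amull x) + limg (amull y))%VS.
  apply: fil_sub => -[|i] j le1.
    case: j le1 => // j _; rewrite expr0 mul1r exprS.
    apply: subvP (addvSr _ _) _ _.
    by have := memv_img (amull y) (memvf (y ^+ j)); rewrite lfunE.
  apply: subvP (addvSl _ _) _ _.
  have := memv_img (amull x) (memvf (x ^+ i * y ^+ j)).
  by rewrite lfunE /= mulrA -exprS.
move/sub => /memv_addP[_ /memv_imgP[b _ ->] [_ /memv_imgP[c _ ->] ->]].
by exists b, c; rewrite !lfunE.
Qed.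

Lemma fil1_lin a :
  a \in fil 1 -> exists b c r, r \in fil 2 /\ a = b *: x + c *: y + r.
Proof.
have /subvP sub : (fil 1 <= <[x]> + <[y]> + fil 2)%VS.
  apply: fil_sub => i j le1; have [le2|lt2] := leqP 2 (i + j).
    exact: subvP (addvSr _ _) _ (monomial_fil le2).
  apply: subvP (addvSl _ _) _ _.
  have [[-> ->]|[-> ->]] : i = 1 /\ j = 0 \/ i = 0 /\ j = 1 by lia.
    by rewrite expr1 expr0 mulr1 (subvP (addvSl _ _)) ?memv_line.
  by rewrite expr1 expr0 mul1r (subvP (addvSr _ _)) ?memv_line.
move/sub => /memv_addP[_ /memv_addP[_ /vlineP[b ->] [_ /vlineP[c ->] ->]]].
by move=> [r r2 ->]; exists b, c, r.
Qed.

Lemma fil0_lin a : exists c r, r \in fil 1 /\ a = c%:A + r.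
Proof.
have /subvP sub : (fil 0 <= <[1]> + fil 1)%VS.
  apply: fil_sub => i j _; have [le1|] := leqP 1 (i + j).
    exact: subvP (addvSr _ _) _ (monomial_fil le1).
  rewrite ltnS leqn0 addn_eq0 => /andP[/eqP -> /eqP ->].
  by rewrite !expr0 mulr1 (subvP (addvSl _ _)) ?memv_line.
have := sub a; rewrite spanA memvf => /(_ isT).
by move=> /memv_addP[_ /vlineP[c ->] [r r1 ->]]; exists c, r.
Qed.

(** Multiplication by x^(p-2) y^(p-1) sends [fil 2] to degree 2p - 1, hence to zero, but sends
    [b x + c y] to [b] times the socle element x^(p-1) y^(p-1). Exchanging the roles of [x] and [y]
    isolates [c]. *)
Lemma fil2_lin_eq0 b c : b *: x + c *: y \in fil 2 -> b = 0 /\ c = 0.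
Proof.
move=> h2.
have z a : a \in fil p.*2.-1 -> a = 0 by rewrite fil_eq0 // memv0 => /eqP.
have e1 : x * (x ^+ p.-2 * y ^+ p.-1) = x ^+ p.-1 * y ^+ p.-1.
  by rewrite mulrA -exprS prednK // -ltnS prednK // ltnW.
have e2 : y * (x ^+ p.-1 * y ^+ p.-2) = x ^+ p.-1 * y ^+ p.-1.
  by rewrite mulCA -exprS prednK // -ltnS prednK // ltnW.
have yp : y * y ^+ p.-1 = 0 by rewrite -exprS prednK // ltnW.
have xp : x * x ^+ p.-1 = 0 by rewrite -exprS prednK // ltnW.
split; apply/eqP.
  have : (b *: x + c *: y) * (x ^+ p.-2 * y ^+ p.-1) = 0.
    apply/z; have -> : p.*2.-1 = (2 + (p.-2 + p.-1))%N by lia.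
    by apply/fil_mul/monomial_fil.
  rewrite mulrDl -!scalerAl e1 mulCA yp mulr0 scaler0 addr0.
  by move/eqP; rewrite scaler_eq0 (negPf xy_neq0) orbF.
have : (b *: x + c *: y) * (x ^+ p.-1 * y ^+ p.-2) = 0.
  apply/z; have -> : p.*2.-1 = (2 + (p.-1 + p.-2))%N by lia.
  by apply/fil_mul/monomial_fil.
rewrite mulrDl -!scalerAl e2 mulrA xp mul0r scaler0 add0r.
by move/eqP; rewrite scaler_eq0 (negPf xy_neq0) orbF.
Qed.

Lemma fil1_nilp a : a \in fil 1 -> a ^+ p.*2.-1 = 0.
Proof.
by move/(@fil_exp 1 _ p.*2.-1); rewrite mul1n fil_eq0 // memv0 => /eqP.
Qed.

(** The geometric series of a nilpotent element is finite. *)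
Lemma fil1_unit a : a \in fil 1 -> exists b, b * (1 - a) = 1.
Proof.
move/fil1_nilp => a0; exists (\sum_(i < p.*2.-1) a ^+ i).
by apply/oppr_inj; rewrite mulC -mulNr opprB -subrX1 a0 sub0r.
Qed.

Lemma fil1_1 : 1 \notin fil 1.
Proof. by apply/negP => /fil1_nilp/eqP; rewrite expr1n oner_eq0. Qed.

(** [fil 1] is itself a maximal left ideal, having residue field [k]. Conversely, a maximal left
    ideal missing some [u] in [fil 1] would contain an element [1 - a u], which is invertible. *)
Lemma Rad_fil : Rad A = fil 1.
Proof.
apply/vspaceP => u; apply/idP/idP => [/mem_Rad|u1].
  apply; split=> [|e|J lJ sJ].
  - by apply/prodvP => a b _; apply: fil_mull.
  - by have := fil1_1; rewrite e memvf.
  have [sJ1|/subvPn[v vJ v1]] := boolP (J <= fil 1)%VS.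
    by left; apply/eqP; rewrite eqEsubv sJ1.
  right; apply/eqP; rewrite eqEsubv subvf /=; apply/subvP => w _.
  suff J1 : 1 \in J by rewrite -[w]mulr1; apply/(subvP lJ)/memv_mul/J1/memvf.
  have [c [r [r1 ev]]] := fil0_lin v.
  have c0 : c != 0.
    by apply: contraNneq v1 => c0; rewrite ev c0 scale0r add0r.
  have : c^-1 *: (v - r) \in J by rewrite memvZ // memvB // (subvP sJ).
  by rewrite ev addrK scalerA mulVf // scale1r.
apply/mem_Rad => I [lI ntI maxI]; apply/negPn/negP => uI.
have lIu : left_ideal (I + fullv * <[u]>)%VS.
  rewrite /left_ideal prodvDr prodvA.
  by apply: addvS; [exact: lI | apply/prodvSl/subvf].
have [e|e] := maxI _ lIu (addvSl _ _).
  move/negP: uI; apply; rewrite -e (subvP (addvSr _ _)) //.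
  by have := memv_mul (memvf 1) (memv_line u); rewrite mul1r.
have /memv_addP[i iI [_ /memv_cosetP[a _ ->] e1]] : 1 \in (I + fullv * <[u]>)%VS.
  by rewrite e memvf.
have [b] := fil1_unit (fil_mull a u1).
rewrite e1 addrK -e1 => bi1; apply: ntI; apply/eqP.
rewrite eqEsubv subvf /=; apply/subvP => w _.
rewrite -[w]mulr1 -bi1 mulrA; apply/(subvP lI)/memv_mul/iI/memvf.
Qed.

Lemma Rad2_fil : (Rad A * Rad A)%VS = fil 2.
Proof.
rewrite Rad_fil; apply/eqP; rewrite eqEsubv; apply/andP; split.
  by apply/prodvP => a b a1 b1; apply: (@fil_mul 1 1).
apply: fil_sub => -[|i] j le2.
  rewrite expr0 mul1r; case: j le2 => // j; rewrite ltnS => le1.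
  rewrite exprS memv_mul ?y_fil1 //.
  by have := @monomial_fil 0 j 1; rewrite expr0 mul1r; apply.
by rewrite exprS -mulrA memv_mul ?x_fil1 // monomial_fil.
Qed.

Lemma dim_le_sqr : (\dim {:A} <= p * p)%N.
Proof.
rewrite -spanA; apply: (leq_trans (dimv_leq_sum _ _ _)).
rewrite -[X in (_ <= X * _)%N]card_ord -[X in (_ <= _ * X)%N]card_ord -card_prod.
by rewrite -sum1_card; apply: leq_sum => ij _; rewrite dim_vline leq_b1.
Qed.

(** Frobenius is additive on a commutative algebra and kills [x b] and [y c]. *)
Lemma fil1_expp u : p \in [pchar k] -> u \in fil 1 -> u ^+ p = 0.
Proof.
move=> pk /fil1_ideal[b [c ->]].
have pA : p \in [pchar A] by rewrite (pchar_lalg A).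
have := pFrobenius_autD_comm pA (mulC (x * b) (y * c)).
by rewrite !pFrobenius_autE !exprM_comm xp0 yp0 !mul0r addr0.
Qed.

(** As [y' ^+ p = 0], only the term [b x'] of [u] matters to leading order: u^n y'^(p-1) agrees with
    b^n x'^n y'^(p-1) up to degree [p + n], one above that of the main term. At [n = p.-1] the error
    has degree 2p - 1 and vanishes. *)
Lemma socle_neq0 x' y' u (b c : k) r :
  x' \in fil 1 -> y' \in fil 1 -> y' ^+ p = 0 -> x' ^+ p.-1 * y' ^+ p.-1 != 0 ->
  b != 0 -> r \in fil 2 -> u = b *: x' + c *: y' + r ->
  u ^+ p.-1 * y' ^+ p.-1 != 0.
Proof.
move=> x1 y1 yp nz b0 r2 eu.
have u1 : u \in fil 1.
  by rewrite eu !memvD ?memvZ // (subvP (filS _) _ r2).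
have H n : u ^+ n * y' ^+ p.-1 - b ^+ n *: (x' ^+ n * y' ^+ p.-1) \in fil (p + n).
  elim: n => [|n IH]; first by rewrite !expr0 scale1r subrr mem0v.
  set X := x' ^+ n * y' ^+ p.-1 in IH *.
  have eX : x' ^+ n.+1 * y' ^+ p.-1 = x' * X by rewrite exprS mulrA.
  have yX : y' * X = 0 by rewrite mulCA -exprS prednK ?yp ?mulr0 // ltnW.
  have -> : u ^+ n.+1 * y' ^+ p.-1 - b ^+ n.+1 *: (x' ^+ n.+1 * y' ^+ p.-1) =
      u * (u ^+ n * y' ^+ p.-1 - b ^+ n *: X) + b ^+ n *: (r * X).
    have uX : u * X = b *: (x' * X) + r * X.
      by rewrite {1}eu !mulrDl -!scalerAl yX scaler0 addr0.
    rewrite mulrBr -scalerAr uX scalerDr opprD addrA scalerA -exprSr subrK eX.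
    by rewrite exprS -mulrA.
  have X1 : X \in fil (n + p.-1).
    by apply: fil_mul; rewrite -[X in fil X]mul1n fil_exp.
  apply: memvD; last apply: memvZ.
    by rewrite addnS -add1n fil_mul.
  have -> : (p + n.+1 = 2 + (n + p.-1))%N by lia.
  exact: fil_mul.
have := H p.-1; rewrite fil_eq0; last by lia.
rewrite memv0 subr_eq0 => /eqP ->.
by rewrite scaler_eq0 (negPf nz) orbF expf_neq0.
Qed.

(** Induction on the total degree. Multiplying the relation by u^(p-1-i) w^(p-1-j) kills every
    monomial exceeding (i, j) in some exponent; the others, apart from (i, j) itself, have smaller
    degree and coefficient zero by induction. What remains is [c i j] times a nonzero element. *)
Lemma monomials_indep (u w : A) (c : 'I_p -> 'I_p -> k) :
  u ^+ p = 0 -> w ^+ p = 0 -> u ^+ p.-1 * w ^+ p.-1 != 0 ->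
  \sum_i \sum_j c i j *: (u ^+ i * w ^+ j) = 0 -> forall i j, c i j = 0.
Proof.
move=> up wp nz e0.
suff H n : forall i j : 'I_p, (i + j < n)%N -> c i j = 0.
  by move=> i j; apply: (H (i + j).+1).
elim: n => // n IH i j; rewrite ltnS => le_n.
have ip := ltn_ord i; have jp := ltn_ord j.
have := congr1 ( *%R (u ^+ (p.-1 - i) * w ^+ (p.-1 - j))) e0.
rewrite mulr0 mulr_sumr (bigD1 i) //= mulr_sumr (bigD1 j) //=.
have T i' j' : u ^+ (p.-1 - i) * w ^+ (p.-1 - j) * (c i' j' *: (u ^+ i' * w ^+ j'))
    = c i' j' *: (u ^+ (p.-1 - i + i') * w ^+ (p.-1 - j + j')).
  by rewrite -scalerAr mulACA -!exprD.
rewrite big1 => [|j' nj]; last first.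
  rewrite T; have [lt_j|le_j] := ltnP j j'.
    by rewrite (expr_ge_eq0 wp) ?mulr0 ?scaler0 //; lia.
  rewrite IH ?scale0r //; have := nj; rewrite -val_eqE /=; lia.
rewrite addr0 big1 => [|i' ni]; last first.
  rewrite mulr_sumr big1 // => j' _.
  rewrite T; have [lt_i|le_i] := ltnP i i'.
    by rewrite (expr_ge_eq0 up) ?mul0r ?scaler0 //; lia.
  have [lt_j|le_j] := ltnP j j'.
    by rewrite (expr_ge_eq0 wp) ?mulr0 ?scaler0 //; lia.
  rewrite IH ?scale0r //; have := ni; rewrite -val_eqE /=; lia.
rewrite addr0 T !subnK; try lia.
by move/eqP; rewrite scaler_eq0 (negPf nz) orbF => /eqP.
Qed.

(** There are p^2 independent monomials and the dimension is at most p^2. *)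
Lemma monomials_span (u w : A) :
  u ^+ p = 0 -> w ^+ p = 0 -> u ^+ p.-1 * w ^+ p.-1 != 0 ->
  forall a, exists c : 'I_p -> 'I_p -> k,
    a = \sum_i \sum_j c i j *: (u ^+ i * w ^+ j).
Proof.
move=> up wp nz a.
pose F (ij : 'I_p * 'I_p) := u ^+ ij.1 * w ^+ ij.2.
have [c0||c ->] := @indep_family_span _ _ _ F _ _ a.
- move=> e0 [i j]; apply: (monomials_indep up wp nz (c := fun i j => c0 (i, j))).
  by rewrite (pair_bigA _ (fun i j => c0 (i, j) *: (u ^+ i * w ^+ j))) -[RHS]e0;
     apply: eq_bigr => -[].
- by rewrite card_prod !card_ord dim_le_sqr.
exists (fun i j => c (i, j)).
by rewrite (pair_bigA _ (fun i j => c (i, j) *: (u ^+ i * w ^+ j)));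
   apply: eq_bigr => -[].
Qed.

(** With a nonzero constant term, [u] would be invertible, hence not nilpotent. *)
Lemma nilp_fil1 u n : u ^+ n = 0 -> u \in fil 1.
Proof.
move=> un; have [c [r [r1 eu]]] := fil0_lin u.
have [c0|c0] := eqVneq c 0; first by rewrite eu c0 scale0r add0r.
have [b] : exists b, b * (1 - - (c^-1 *: r)) = 1.
  by apply: fil1_unit; rewrite memvN memvZ.
have -> : 1 - - (c^-1 *: r) = c^-1 *: u.
  by rewrite opprK eu scalerDr scalerA mulVf // scale1r.
move/(congr1 (fun a => a ^+ n))/eqP.
by rewrite exprM_comm exprZn un scaler0 mulr0 expr1n eq_sym oner_eq0.
Qed.

(* If [u = alpha 'qX] were in Rad^2, then [z = x^(p-1) y^(p-2)] would be killed
   by [u], hence be a multiple of [u^(p-1)] by projectivity, whence [y z = 0]. *)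
Lemma ppoint_Rad (alpha : {lrmorphism truncated k p -> A}) :
  projective (restr_scalars alpha) ->
  alpha 'qX \in Rad A /\ alpha 'qX \notin (Rad A * Rad A)%VS.
Proof.
have p_gt0 := ltnW p_gt1.
move=> proj; rewrite Rad2_fil Rad_fil; split.
  by apply: (@nilp_fil1 _ p); rewrite -rmorphXn qXp // rmorph0.
apply/negP => u2; set u := alpha 'qX in u2.
have z a : a \in fil p.*2.-1 -> a = 0 by rewrite fil_eq0 // memv0 => /eqP.
have [|b eb] := projective_ann p_gt0 (z := x ^+ p.-1 * y ^+ p.-2) proj.
  apply/z; have -> : p.*2.-1 = (2 + (p.-1 + p.-2))%N by lia.
  by apply/fil_mul/monomial_fil.
move/eqP: xy_neq0; apply; apply/z.
have -> : x ^+ p.-1 * y ^+ p.-1 = y * (x ^+ p.-1 * y ^+ p.-2).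
  by rewrite mulCA -exprS prednK // -ltnS prednK // ltnW.
(* u^(p-1) has degree 2p - 2 if [u] has degree 2, and the factor [y] reaches the degree where [fil]
   vanishes. *)
rewrite eb; have -> : p.*2.-1 = (1 + 2 * p.-1)%N by lia.
by rewrite fil_mul ?y_fil1 ?fil_mulr ?fil_exp.
Qed.

(** The linear part of [u] involves [x] or [y]; with the other generator as [w], the monomials in
    [u] and [w] form a basis, so the algebra is free over the subalgebra generated by [u]. *)
Lemma exists_ppoint u :
  p \in [pchar k] -> u \in Rad A -> u \notin (Rad A * Rad A)%VS ->
  exists alpha : {lrmorphism truncated k p -> A},
    projective (restr_scalars alpha) /\ alpha 'qX = u.
Proof.
have p_gt0 := ltnW p_gt1.
rewrite Rad2_fil Rad_fil => pk u1 u2.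
have up := fil1_expp pk u1.
have [alpha au] := exists_point_hom p_gt0 up; exists alpha; split=> //.
suff [w [wp nz]] : exists w, w ^+ p = 0 /\ u ^+ p.-1 * w ^+ p.-1 != 0.
  apply: (@projective_of_basis _ _ p_gt0 _ _ w); rewrite au.
    by move=> c; apply: monomials_indep.
  exact: monomials_span.
have [b [c [r [r2 eu]]]] := fil1_lin u1.
have [b0|b0] := eqVneq b 0; last first.
  by exists y; split=> //; apply: socle_neq0 b0 r2 eu; rewrite ?x_fil1 ?y_fil1.
have c0 : c != 0.
  by apply: contraNneq u2 => c0; rewrite eu b0 c0 !scale0r !add0r.
exists x; split=> //; apply: (socle_neq0 _ _ _ _ c0 r2 (x' := y) (c := b)).
- exact: y_fil1.
- exact: x_fil1.
- by [].
- by rewrite mulC.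
- by rewrite eu [_ *: x + _]addrC.
Qed.

End TruncatedAlgebra.

(** * The generic kernel *)

Lemma mcoeff_mulXn_eq0 (n p : nat) (k : nzRingType) (q : {mpoly k[n]}) i
    (m : 'X_{1..n}) : (m i < p)%N -> (q * 'X_i ^+ p)@_m = 0.
Proof.
move=> lt_mp; apply/memN_msupp_eq0.
rewrite mpolyXn (perm_mem (msuppMX _ _)).
apply/mapP => -[m' _ em]; move: lt_mp.
by rewrite em mnmDE mulmnE mnm1E eqxx mul1n ltnNge leq_addr.
Qed.

Lemma rank2_generators (k : fieldType) (p : nat) (E : finGroupScheme k) :
  (0 < p)%N -> abelian_unipotent_rank p E 2 ->
  exists x y : measures E,
    [/\ commutative (@GRing.mul (measures E)), x ^+ p = 0, y ^+ p = 0,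
        x ^+ p.-1 * y ^+ p.-1 != 0 & fil p x y 0 = fullv].
Proof.
move=> p_gt0 [f [f_surj f_ker]].
have Xp i : f 'X_i ^+ p = 0.
  rewrite -rmorphXn; apply/f_ker; exists (fun j => if j == i then 1 else 0).
  rewrite (bigD1 i) //= eqxx mul1r big1 ?addr0 // => j /negPf->.
  by rewrite mul0r.
exists (f 'X_0), (f 'X_1); split=> //.
- by move=> a b; have [q <-] := f_surj a; have [r <-] := f_surj b;
    rewrite -!rmorphM mulrC.
- rewrite -!rmorphXn -rmorphM; apply/eqP => /f_ker[h].
  (* Elements of the ideal (X_0^p, X_1^p) have coefficient zero at the monomial with both exponents
     [p.-1]. *)
  move/(congr1 (mcoeff [multinom p.-1 | i < 2])).
  rewrite raddf_sum big1 => [|i _]; last first.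
    by rewrite /= mcoeff_mulXn_eq0 // mnmE prednK.
  rewrite !mpolyXn -mpolyXD mcoeffX; case: eqP => [_ /eqP|ne _].
    by rewrite oner_eq0.
  apply: ne; apply/mnmP => i; rewrite mnmDE !mulmnE !mnm1E mnmE.
  by case: i => -[|[|[]]] //= lt; rewrite ?mul1n ?mul0n ?addn0.
apply/eqP; rewrite eqEsubv subvf /=; apply/subvP => u _.
have [q <-] := f_surj u; rewrite (mpolyE q) linear_sum.
apply: memv_suml => m _; rewrite linearZ memvZ // mpolyXE_id big_ord_recl big_ord1.
have -> : lift ord0 ord0 = 1 :> 'I_2 by apply/val_inj.
by rewrite rmorphM !rmorphXn; apply: (monomial_fil (Xp 0) (Xp 1)).
Qed.

(** The interface to the module theory: from here on only these facts about the algebra of measures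
    are used, not its presentation. *)
Lemma rank2_ppoints (k : fieldType) (p : nat) (E : finGroupScheme k)
    (R := Rad (measures E)) :
  p \in [pchar k] -> abelian_unipotent_rank p E 2 ->
  exists x y : measures E,
    [/\ commutative (@GRing.mul (measures E)),
        x \in R /\ y \in R,
        forall a b, (a != 0) || (b != 0) -> a *: x + b *: y \notin (R * R)%VS,
        forall u, u \in R -> exists b c, u = x * b + y * c
      & (forall u, u \in R -> u \notin (R * R)%VS ->
           exists alpha : {lrmorphism truncated k p -> measures E},
             p_point alpha /\ alpha 'qX = u) /\
        (forall alpha : {lrmorphism truncated k p -> measures E},
           p_point alpha -> alpha 'qX \in R /\ alpha 'qX \notin (R * R)%VS)].
Proof.
move=> pk rk; have p_gt1 := prime_gt1 (pcharf_prime pk).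
have [x [y [mulC xp yp nz span]]] := rank2_generators (ltnW p_gt1) rk.
have eR : R = fil p x y 1 by apply: Rad_fil.
have eR2 : (R * R)%VS = fil p x y 2 by apply: Rad2_fil.
exists x, y; split=> //.
- by rewrite eR; split; [apply: x_fil1 | apply: y_fil1].
- move=> a b; rewrite eR2; apply: contraL => /(fil2_lin_eq0 mulC p_gt1 xp yp nz)[-> ->].
  by rewrite eqxx.
- by rewrite eR => u; apply: fil1_ideal.
split=> [u uR uR2|alpha pa].
  exact: (exists_ppoint mulC p_gt1 xp yp nz span pk uR uR2).
exact: (ppoint_Rad mulC p_gt1 xp yp nz span pa).
Qed.

Lemma generic_kernelP (k : fieldType) (p : nat) (E : finGroupScheme k)
    (M : schemeModule E) (K := generic_kernel p M) :
  (submodule K /\ equal_images p K) /\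
  forall N : {vspace M}, submodule N /\ equal_images p N -> (N <= K)%VS.
Proof.
by rewrite /K /generic_kernel; case: constructive_indefinite_description.
Qed.

(** The sum of kernels given by [constant_rank_pencil] is an equal images submodule, so [K] contains
    it and with it the kernel of [x]. Equal images for exponent 1 and constant rank then carry this
    over from [x] to every [u] by counting dimensions. *)
Lemma generic_kernel_constant_rank (k : closedFieldType) (p : nat)
    (E : finGroupScheme k) (M : schemeModule E) (d : nat)
    (R := Rad (measures E)) (K := generic_kernel p M) :
  p \in [pchar k] -> abelian_unipotent_rank p E 2 -> constant_rank p M d ->
  exists W : {vspace M}, forall u, u \in R -> u \notin (R * R)%VS ->
    (act M u @: K)%VS = W /\ (lker (act M u) <= K)%VS.
Proof.
move=> pk rk hM; have p_gt1 := prime_gt1 (pcharf_prime pk).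
have [x [y [mulC [xR yR] linU idealR [Upp ppU]]]] := rank2_ppoints pk rk.
have rkU u : u \in R -> u \notin (R * R)%VS -> \dim (limg (act M u)) = d.
  by move=> uR uR2; have [alpha [pa <-]] := Upp u uR uR2; apply: hM.
have xR2 : x \notin (R * R)%VS.
  by have := linU 1 0; rewrite oner_eq0 scale1r scale0r addr0; apply.
have kerU u : u \in R -> u \notin (R * R)%VS ->
    \dim (lker (act M u)) = \dim (lker (act M x)).
  by move=> uR uR2; rewrite !dim_lker !rkU.
have actC u v w : act M u (act M v w) = act M v (act M u w).
  by rewrite -!comp_lfunE -!actM mulC.
have [|s] := @constant_rank_pencil k M (act M x) (act M y) d.
  move=> a b ab; rewrite -!linearZ -linearD; apply: rkU; last exact: linU.
  by rewrite memvD ?memvZ.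
set N := (\sum_(c <- s) _)%VS => -[gN kerN].
have subN : submodule N.
  move=> u; rewrite limg_sum; apply: (big_ind2 (fun U V => U <= V)%VS) => //.
    by move=> *; apply: addvS.
  move=> c _; apply/subvP => _ /memv_imgP[v + ->].
  rewrite !memv_ker !add_lfunE !scale_lfunE => /eqP v0.
  by rewrite (actC x u) (actC y u) -linearP v0 linear0.
(* Writing [u = x b + y c] gives one inclusion. The dimensions agree because [N'] contains the
   kernel of [x], which is as large as that of [u]. *)
have stepN (N' : {vspace M}) : submodule N' -> (act M y @: N' <= act M x @: N')%VS ->
    (lker (act M x) <= N')%VS -> forall u, u \in R -> u \notin (R * R)%VS ->
    (act M u @: N')%VS = (act M x @: N')%VS.
  move=> subN' yN' kerN' u uR uR2; apply/eqP; rewrite eqEdim; apply/andP; split.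
    have [b [c ->]] := idealR u uR.
    apply/subvP => _ /memv_imgP[v vN ->]; rewrite linearD add_lfunE !actM !comp_lfunE.
    apply: memvD; last apply: (subvP yN'); apply: memv_img.
      by apply: (subvP (subN' b)); apply: memv_img.
    by apply: (subvP (subN' c)); apply: memv_img.
  have := limg_ker_dim (act M x) N'; rewrite (capv_idPr kerN').
  rewrite -(limg_ker_dim (act M u) N') -(kerU u) // => e.
  rewrite -(leq_add2l (\dim (lker (act M u)))) e leq_add2r.
  exact/dimvS/capvSr.
have eqN : equal_images p N.
  move=> l _; exists (act M (x ^+ l) @: N)%VS => alpha /ppU[uR uR2].
  set u := alpha _ in uR uR2 *; elim: l => [|l IH]; first by rewrite !expr0.
  (* The chain is u^(l+1) N = u x^l N = x^l u N = x^l x N. *)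
  rewrite exprS actM limg_comp IH exprSr actM limg_comp.
  rewrite -limg_comp -actM mulC actM limg_comp; congr lfun_img.
  exact: stepN.
have [[subK eqK] maxK] := generic_kernelP p M.
have NK : (N <= K)%VS by apply: maxK.
have [|V VK] := eqK 1%N; first by rewrite p_gt1.
have imK u : u \in R -> u \notin (R * R)%VS -> (act M u @: K)%VS = V.
  by move=> uR uR2; have [alpha [pa <-]] := Upp u uR uR2; rewrite -(VK alpha).
exists V => u uR uR2; split; first exact: imK.
have := limg_ker_dim (act M x) K; rewrite (capv_idPr (subv_trans kerN NK)) imK //.
rewrite -(limg_ker_dim (act M u) K) imK // -(kerU u) // => /addIn e.
suff /eqP <- : (K :&: lker (act M u) == lker (act M u))%VS by apply: capvSl.
by rewrite eqEdim capvSr e leqnn.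
Qed.

(** * Degrees on a line *)

Lemma poly_ext (k : closedFieldType) (q r : {poly k}) :
  (forall a, q.[a] = r.[a]) -> q = r.
Proof.
move=> e; apply/eqP; rewrite -subr_eq0; apply: contraT => /closed_nonrootP[a].
by rewrite rootE hornerD hornerN e subrr eqxx.
Qed.

Lemma biggcdp_dvd (k : fieldType) (I : eqType) (r : seq I) (F : I -> {poly k})
    i :
  i \in r -> \big[@gcdp k/0]_(j <- r) F j %| F i.
Proof.
elim: r => // j r IH; rewrite inE big_cons => /predU1P[->|/IH].
  exact: dvdp_gcdl.
by apply: dvdp_trans; apply: dvdp_gcdr.
Qed.

Section LineRestriction.
Variables (k : closedFieldType) (n : nat) (v w : 'I_n -> k).

(** The projective line through [v] and [w] in the chart [v + X w]; the missing point [w] is seen by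
    the coefficient of top degree. *)
Definition line_restr (f : {mpoly k[n]}) : {poly k} :=
  mmap polyC (fun i => (v i)%:P + w i *: 'X) f.

HB.instance Definition _ := GRing.RMorphism.copy line_restr
  (mmap polyC (fun i => (v i)%:P + w i *: 'X)).

Lemma horner_line_restr f a : (line_restr f).[a] = f.@[fun i => v i + a * w i].
Proof.
rewrite /line_restr /mmap mevalE horner_sum; apply: eq_bigr => m _.
rewrite hornerM hornerC /mmap1 horner_prod; congr (_ * _); apply: eq_bigr => i _.
by rewrite horner_exp hornerD hornerC hornerZ hornerX mulrC.
Qed.

Lemma line_restr_monomial (m : 'X_{1..n}) :
  let q := mmap1 (fun i => (v i)%:P + w i *: 'X) m in
  (size q <= (mdeg m).+1)%N /\ q`_(mdeg m) = \prod_i w i ^+ m i.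
Proof.
(* Size bounds instead of exact sizes allow top coefficients that vanish. *)
have coefM_top (q r : {poly k}) a b : (size q <= a.+1)%N -> (size r <= b.+1)%N ->
    (size (q * r)%R <= (a + b).+1)%N /\ (q * r)`_(a + b) = q`_a * r`_b.
  move=> sq sr; split.
    by apply: (leq_trans (size_polyMleq _ _)); lia.
  rewrite coefM (bigD1 (inord a)) //= inordK ?ltnS ?leq_addr // addKn.
  rewrite big1 ?addr0 // => i ni; have [lt_ia|le_ai] := ltnP i a.
    by rewrite [r`__]nth_default ?mulr0 // (leq_trans sr) //; lia.
  rewrite nth_default ?mul0r // (leq_trans sq) // ltn_neqAle le_ai andbT.
  apply: contra ni => /eqP e; apply/eqP/val_inj.
  by rewrite /= inordK ?ltnS ?leq_addr.
pose lin i := (v i)%:P + w i *: 'X : {poly k}.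
have lin_size i : (size (lin i) <= 2)%N.
  rewrite (leq_trans (size_polyD _ _)) // geq_max size_polyC.
  rewrite (leq_trans (size_scale_leq _ _)) ?size_polyX //.
  by case: eqP.
have lin_coef i : (lin i)`_1 = w i.
  by rewrite coefD coefC coefZ coefX mulr1 add0r.
have linX i e : (size (lin i ^+ e)%R <= e.+1)%N /\ (lin i ^+ e)`_e = w i ^+ e.
  elim: e => [|e [IHs IHc]]; first by rewrite !expr0 size_poly1 coefC.
  by have [] := coefM_top _ _ _ _ (lin_size i) IHs; rewrite !exprS lin_coef IHc.
rewrite /= /mmap1 mdegE.
apply: (big_rec3 (fun (q : {poly k}) (e : nat) (c : k) =>
   (size q <= e.+1)%N /\ q`_e = c)) => [|i q e c _ [IHs IHc]].
  by rewrite size_poly1 coefC.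
have [sX cX] := linX i (m i).
by have [s1 c1] := coefM_top _ _ _ _ sX IHs; rewrite c1 cX IHc.
Qed.

Lemma size_line_restr f : (size (line_restr f) <= msize f)%N.
Proof.
rewrite /line_restr /mmap; apply: (leq_trans (size_sum _ _ _)).
apply/bigmax_leqP_seq => m mf _; rewrite mul_polyC.
apply: (leq_trans (size_scale_leq _ _)); have [+ _] := line_restr_monomial m.
by move/leq_trans; apply; apply: msize_mdeg_lt.
Qed.

Lemma coef_line_restr f D : f \is D.-homog -> (line_restr f)`_D = f.@[w].
Proof.
move/dhomogP => hf; rewrite /line_restr /mmap coef_sum mevalE.
rewrite big_seq [RHS]big_seq; apply: eq_bigr => m mf; rewrite mul_polyC coefZ.
by have [_] := line_restr_monomial m; rewrite hf // => ->.
Qed.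

(** The coefficient of degree [D] on the line is the value at [w], so nothing is lost in
    restricting; [size] and [msize] are one more than the degree. *)
Lemma size_line_restr_homog f D :
  f \is D.-homog -> f.@[w] != 0 -> size (line_restr f) = D.+1 /\ msize f = D.+1.
Proof.
move=> hf fw.
have le1 : (msize f <= D.+1)%N.
  rewrite msizeE; apply/bigmax_leqP_seq => m mf _.
  by rewrite (dhomog_mf hf).
have le2 : (D < size (line_restr f))%N.
  rewrite ltnNge; apply/negP => le; move/negP: fw; apply.
  by rewrite -(coef_line_restr hf) nth_default.
have := size_line_restr f; lia.
Qed.

(* The restriction to the line of a common factor [g] has no root, but degree
   [deg g], because restriction preserves the degree of [f i] for some [i]. *)
Lemma line_no_common_factor (I : finType) (f : I -> {mpoly k[n]}) D :
  (forall i, f i \is D.-homog) ->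
  (forall a, exists i, (f i).@[fun j => v j + a * w j] != 0) ->
  (exists i, (f i).@[w] != 0) -> no_common_factor f.
Proof.
move=> hf nz [j0 nzw] g gf.
have [h eh] := gf j0; have [sF mF] := size_line_restr_homog (hf j0) nzw.
have f0 : f j0 != 0 by apply: contraNneq nzw => ->; rewrite meval0.
have [g0 h0] : g != 0 /\ h != 0.
  by apply/andP; rewrite -negb_or -mulf_eq0 -eh.
have L0 q : line_restr q != 0 -> (0 < size (line_restr q))%N.
  by rewrite size_poly_gt0.
have [Lg0 Lh0] : line_restr g != 0 /\ line_restr h != 0.
  apply/andP; rewrite -negb_or -mulf_eq0 -rmorphM -eh.
  by rewrite -size_poly_eq0 sF.
have := size_mul Lg0 Lh0; rewrite -rmorphM -eh /= sF.
have := msizeM g0 h0; rewrite -eh mF.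
have := size_line_restr g; have := size_line_restr h.
have := L0 _ Lg0; have := L0 _ Lh0 => p1 p2 le1 le2 e1 e2.
(* Degrees add up for [f j0 = g * h] before and after restriction, and neither factor can gain
   degree, so neither loses any. *)
have arith (a b a' b' c : nat) : (0 < b -> 0 < a -> b <= b' -> a <= a' ->
    c = (a' + b').-1 -> c = (a + b).-1 -> a = a')%N by lia.
have eg : size (line_restr g) = msize g := arith _ _ _ _ _ p1 p2 le1 le2 e1 e2.
have sg : size (line_restr g) == 1%N.
  apply: contraT => /closed_rootP[a]; rewrite rootE horner_line_restr => /eqP ga.
  have [i] := nz a; have [hi ->] := gf i.
  by rewrite mevalM ga mul0r eqxx.
move: sg; rewrite eg => /msize_poly1P[c c0 ->].
by apply/unitrP; exists (c^-1)%:MP; rewrite -!mpolyCM mulVf ?divff.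
Qed.

(* On the line, [f j] divides [f' j * f i] for all [i], hence it divides [f' j],
   the [f i] having no common root. *)
Lemma line_degree_le (I : finType) (f f' : I -> {mpoly k[n]}) D D' :
  (forall i, f i \is D.-homog) -> (forall i, f' i \is D'.-homog) ->
  (forall a, exists i, (f i).@[fun j => v j + a * w j] != 0) ->
  (exists i, (f i).@[w] != 0 /\ (f' i).@[w] != 0) ->
  (forall a i j, let e := fun j => v j + a * w j in
     (f i).@[e] * (f' j).@[e] = (f j).@[e] * (f' i).@[e]) ->
  (D <= D')%N.
Proof.
move=> hf hf' nz [j0 [nzw nzw']] cross.
have [sF _] := size_line_restr_homog (hf j0) nzw.
have [sF' _] := size_line_restr_homog (hf' j0) nzw'.
pose F i := line_restr (f i); pose F' i := line_restr (f' i).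
have crossF i j : F i * F' j = F j * F' i.
  by apply: poly_ext => a; rewrite !hornerM !horner_line_restr; apply: cross.
pose G := \big[@gcdp k/0]_i F i.
have sG : size G == 1%N.
  apply: contraT => /closed_rootP[a]; rewrite -dvdp_XsubCl => aG.
  have [i] := nz a; rewrite -horner_line_restr -[_ == 0]/(root _ a).
  rewrite -dvdp_XsubCl; case/negP.
  by rewrite (dvdp_trans aG) // biggcdp_dvd ?mem_index_enum.
have : F j0 %| F' j0 * G.
  rewrite /G; apply: (big_ind (fun q => F j0 %| F' j0 * q)) => [|q r hq hr|i _].
  - by rewrite mulr0 dvdp0.
  - by rewrite (eqp_dvdr _ (mulp_gcdr _ _ _)) dvdp_gcd hq hr.
  - by rewrite mulrC crossF dvdp_mulr.
have /size_poly1P[c c0 ->] := sG.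
rewrite mulrC mul_polyC dvdpZr // => /dvdp_leq.
by rewrite -size_poly_eq0 sF' sF; apply.
Qed.

End LineRestriction.

(** * Pluecker coordinates *)

(** Enumerating the image in its natural order sorts it. This turns a choice of independent columns
    into an index of a Pluecker coordinate. *)
Lemma exists_increasing_image (d m : nat) (f : 'I_d -> 'I_m) :
  injective f -> exists s : increasing d m, forall i, exists j, val s j = f i.
Proof.
move=> f_inj; pose S := [set f i | i : 'I_d].
have cS : #|S| = d by rewrite card_imset ?card_ord.
pose s := [ffun i : 'I_d => enum_val (cast_ord (esym cS) i)].
have nth_s (i : 'I_d) : (s i : nat) = nth 0%N [seq val x | x <- enum S] i.
  rewrite ffunE /enum_val -(nth_map (enum_default _) 0%N) //=.
  by rewrite -cardE cS.
have srt : sorted ltn [seq val x | x <- enum S].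
  rewrite sorted_map /enum_mem; apply: sorted_filter.
    by move=> a b c; apply: ltn_trans.
  by rewrite -enumT -sorted_map val_enum_ord iota_ltn_sorted.
have sP : [forall i : 'I_d, forall j : 'I_d, (i < j)%N ==> (s i < s j)%N].
  apply/forallP => i; apply/forallP => j; apply/implyP => lt_ij; rewrite !nth_s.
  by apply: (sorted_ltn_nth ltn_trans) => //; rewrite inE size_map -cardE cS.
exists (Sub s sP) => i.
have fS : f i \in S by apply: imset_f.
exists (cast_ord cS (enum_rank_in fS (f i))).
by rewrite SubK ffunE cast_ordK enum_rankK_in.
Qed.

Section Plucker.
Variables (k : fieldType) (M : vectType k) (d : nat).

Definition coord_mx (b : d.-tuple M) : 'M[k]_(d, \dim {:M}) :=
  \matrix_(i, j) coord (vbasis {:M}) j (tnth b i).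

Lemma plucker_minorE (b : d.-tuple M) (s : increasing d (\dim {:M})) :
  \det (\matrix_(i, j) coord (vbasis {:M}) (val s j) (tnth b i)) =
  \det (colsub (val s) (coord_mx b)).
Proof. by congr (\det _); apply/matrixP => i j; rewrite !mxE. Qed.

(** Transposed because [fullrankfun] selects rows whereas the minors select columns. *)
Lemma coord_mx_full (b : d.-tuple M) : free b -> row_full (coord_mx b)^T.
Proof.
move=> fb; rewrite /row_full mxrank_tr -/(row_free _) -kermx_eq0.
apply/eqP/row_matrixP => i; rewrite row0; set r := row i _.
have : r *m coord_mx b = 0 by apply/sub_kermxP; apply: row_sub.
move=> rb; have e0 : \sum_j r 0 j *: b`_j = 0.
  rewrite (coord_vbasis (memvf (\sum_j r 0 j *: b`_j))) big1 // => l _.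
  have := congr1 (fun r : 'rV_(\dim {:M}) => r 0 l) rb; rewrite !mxE => e.
  rewrite linear_sum [X in X *: _](_ : _ = 0) ?scale0r //.
  rewrite -[RHS]e; apply: eq_bigr => j _.
  by rewrite linearZ [coord_mx b j l]mxE (tnth_nth 0).
by move/freeP: fb => /(_ _ e0) r0; apply/rowP => j; rewrite r0 mxE.
Qed.

(** A matrix of rank [d] has [d] independent columns; listed increasingly, they give a nonzero
    minor. *)
Lemma plucker_neq0 (W : {vspace M}) y :
  plucker (d := d) W y -> exists s, y s != 0.
Proof.
move=> [b [c [bW c0 yE]]]; have full := coord_mx_full (basis_free bW).
have [s hs] := exists_increasing_image (@fullrankfun_inj _ _ _ _ full).
exists s; rewrite yE plucker_minorE mulf_neq0 // -unitfE -[_ \is a _]/(_ \in unitmx).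
rewrite -unitmx_tr -row_full_unit -sub1mx.
apply: (submx_trans (B := rowsub (fullrankfun full) (coord_mx b)^T)).
  by rewrite sub1mx fullrowsub_full.
apply/row_subP => i; have [j ej] := hs i; rewrite row_rowsub -ej.
apply: (eq_row_sub j); apply/rowP => l; by rewrite !mxE.
Qed.

(** A change of basis multiplies all maximal minors by one determinant; the proportionality is
    cross-multiplied to avoid quotients. *)
Lemma plucker_cross (W : {vspace M}) y z : plucker (d := d) W y ->
  plucker W z -> forall s t, y s * z t = y t * z s.
Proof.
move=> [b [c [bW _ yE]]] [b' [c' [bW' _ zE]]] s t.
have eb : coord_mx b' = (\matrix_(i, j) coord b j (tnth b' i)) *m coord_mx b.
  apply/matrixP => i l; rewrite !mxE.
  have bi : tnth b' i \in W by apply: (basis_mem bW'); apply: mem_tnth.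
  rewrite {1}(coord_basis bW bi) linear_sum; apply: eq_bigr => j _.
  by rewrite linearZ !mxE (tnth_nth 0 b).
rewrite !yE !zE !plucker_minorE eb -!mulmx_colsub !det_mulmx.
rewrite !(mulrA c') mulrACA [RHS]mulrACA; congr (_ * _); exact: mulrC.
Qed.

End Plucker.

(** * Homogeneous Pluecker coordinates of the images *)

Section ImageMinors.
Variables (k : fieldType) (M : vectType k) (n d : nat).
Variables (T : 'I_n -> 'End(M)) (W C : {vspace M}).

(** Coordinates of a basis of [W], followed by those of the generic operator [\sum_h 'X_h T_h]
    applied to a basis of [C]. A natural number as row index avoids casts along
    [\dim W + \dim C = d]. *)
Definition image_row (i : nat) (l : 'I_(\dim {:M})) : {mpoly k[n]} :=
  if (i < \dim W)%N then (coord (vbasis {:M}) l (vbasis W)`_i)%:MP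
  else \sum_h coord (vbasis {:M}) l (T h (vbasis C)`_(i - \dim W)) *: 'X_h.

Definition image_minor (s : increasing d (\dim {:M})) : {mpoly k[n]} :=
  \det (\matrix_(i < d, j < d) image_row i (val s j)).

(** Every term of the determinant takes one entry from each row, of degree 0 in the first [\dim W]
    rows and of degree 1 in the others. *)
Lemma image_minor_homog s : image_minor s \is (d - \dim W).-homog.
Proof.
have rowH i l : image_row i l \is (nat_of_bool (\dim W <= i)%N).-homog.
  rewrite /image_row; case: ltnP => _.
    by rewrite -[_%:MP]mulr1 mul_mpolyC rpredZ //; apply: dhomog1.
  by apply: rpred_sum => h _; rewrite rpredZ // dhomogX /= mdeg1.
have degE (e : nat) : (\sum_(i < e) (\dim W <= i) = e - \dim W)%N.
  elim: e => [|e IH]; first by rewrite big_ord0.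
  by rewrite big_ord_recr /= IH; case: leqP; lia.
rewrite /image_minor /determinant; apply: rpred_sum => g _; rewrite rpredMsign -degE.
apply: (big_rec2 (fun e (f : {mpoly k[n]}) => f \is e.-homog)); first exact: dhomog1.
by move=> i e f _ hf; apply: dhomogM => //; rewrite mxE.
Qed.

Lemma image_minor_plucker (x : 'rV[k]_n) (Tx := \sum_i x 0 i *: T i) :
  (\dim W + \dim C)%N = d -> limg Tx = (W + Tx @: C)%VS -> \dim (limg Tx) = d ->
  plucker (limg Tx) (fun s => (image_minor s).@[fun j => x 0 j]).
Proof.
move=> dE imE dimE; pose b := vbasis W ++ map Tx (vbasis C).
have szb : size b == d by rewrite size_cat size_map !size_tuple dE.
exists (Tuple szb), 1; split; last 2 first.
- exact: oner_neq0.
- move=> s; rewrite mul1r /image_minor -det_map_mx; congr (\det _).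
  apply/matrixP => i j; rewrite !mxE (tnth_nth 0) /= nth_cat size_tuple /image_row.
  case: ltnP => [_|le_i]; first by rewrite mevalC.
  have lt_i : (i - \dim W < \dim C)%N by have := ltn_ord i; lia.
  rewrite (nth_map 0) ?size_tuple // /Tx sum_lfunE !linear_sum.
  by apply: eq_bigr => h _; rewrite /= mevalZ mevalXU scale_lfunE linearZ /= mulrC.
rewrite basisEdim /= (eqP szb) dimE leqnn andbT imE span_cat.
by rewrite -limg_span !(span_basis (vbasisP _)) subvv.
Qed.

End ImageMinors.

Theorem corollary6p2p8 (k : closedFieldType) (p : nat) (hp : p \in [pchar k])
    (E : finGroupScheme k) (hE : elementary_abelian p E)
    (rkE : abelian_unipotent_rank p E 2)
    (M : schemeModule E) (d : nat) (hM : constant_rank p M d) (D : nat) :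
  module_degree M d D <-> D = (\dim {:M} - \dim (generic_kernel p M))%N.
Proof.
have [x [y [_ [xR yR] linU _ [Upp _]]]] := rank2_ppoints hp rkE.
have [W KW] := generic_kernel_constant_rank hp rkE hM.
set K := generic_kernel p M in KW *.
set R := Rad (measures E) in xR yR linU Upp KW.
pose elt (z : 'rV[k]_(\dim R)) := \sum_i z 0 i *: (vbasis R)`_i.
have eltR z : elt z \in R.
  by apply: memv_suml => i _; rewrite memvZ // vbasis_mem // mem_nth ?size_tuple.
pose row_of u : 'rV[k]_(\dim R) := \row_i coord (vbasis R) i u.
have elt_row u : u \in R -> elt (row_of u) = u.
  by move=> uR; rewrite {2}(coord_vbasis uR); apply: eq_bigr => i _; rewrite mxE.
(* The line spanned by [x] and [y] lies entirely in the domain; [w] is its point at infinity. *)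
pose v j := row_of x 0 j; pose w j := row_of y 0 j.
have eltD a : elt (row_of x + a *: row_of y) = x + a *: y.
  rewrite -{2}(elt_row x) // -{2}(elt_row y) // /elt scaler_sumr -big_split.
  by apply: eq_bigr => i _; rewrite !mxE scalerDl scalerA.
have lineU a : elt (row_of x + a *: row_of y) \notin (R * R)%VS.
  by rewrite eltD -[x]scale1r linU // oner_eq0.
have yU : elt (row_of y) \notin (R * R)%VS.
  by have := linU 0 1; rewrite oner_eq0 orbT scale0r add0r scale1r elt_row //; apply.
have lineE (f : {mpoly k[\dim R]}) a :
    f.@[fun j => (row_of x + a *: row_of y) 0 j] = f.@[fun j => v j + a * w j].
  by apply: meval_eq => j; rewrite /v /w !mxE.
have rkU u : u \in R -> u \notin (R * R)%VS -> \dim (limg (act M u)) = d.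
  by move=> uR uR2; have [alpha [pa <-]] := Upp u uR uR2; apply: hM.
pose C := (K^C)%VS.
have dimC : \dim C = (\dim {:M} - \dim K)%N by rewrite dimv_compl.
have imE u : u \in R -> u \notin (R * R)%VS ->
    limg (act M u) = (W + act M u @: C)%VS.
  by move=> uR uR2; rewrite -(proj1 (KW u uR uR2)) -limgD addv_complf.
(* As [K] contains the kernel of [u], passing from [K] to [W = u K] loses exactly dim M - d
   dimensions. *)
have dE : (\dim W + \dim C)%N = d.
  have [<- kerK] := KW _ (eltR _) yU.
  have := limg_ker_dim (act M (elt (row_of y))) K; rewrite (capv_idPr kerK) dim_lker.
  rewrite rkU // dimC; have := dimvS (subvf K).
  have : (d <= \dim {:M})%N by rewrite -(rkU _ (eltR _) yU) dimvS ?subvf.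
  lia.
pose T (i : 'I_(\dim R)) := act M (vbasis R)`_i.
have TE z : act M (elt z) = \sum_i z 0 i *: T i.
  by rewrite linear_sum; apply: eq_bigr => i _; rewrite linearZ.
have [f0 [f0H f0P]] : exists f0 : increasing d (\dim {:M}) -> {mpoly k[\dim R]},
    (forall s, f0 s \is (\dim C).-homog) /\
    forall z, elt z \notin (R * R)%VS ->
      plucker (limg (act M (elt z))) (fun s => (f0 s).@[fun j => z 0 j]).
  exists (image_minor T W C); split=> [s|z zU].
    have -> : \dim C = (d - \dim W)%N by rewrite -dE addKn.
    exact: image_minor_homog.
  rewrite TE; apply: image_minor_plucker => //; rewrite -TE; first exact: imE.
  exact: rkU.
have f0nz := fun z zU => plucker_neq0 (f0P z zU).
rewrite -dimC; split=> [[f [fH _ fP]]|->]; last first.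
  (* The minors themselves represent the morphism; having no common zero on the line, they have no
     common factor. *)
  exists f0; split=> //.
  apply: (@line_no_common_factor _ _ v w _ _ (\dim C)) => //.
    by move=> a; have [s] := f0nz _ (lineU a); exists s; rewrite -lineE.
  by have [s] := f0nz _ yU; exists s.
have fnz := fun z zU => plucker_neq0 (fP z zU).
have cross z s t : elt z \notin (R * R)%VS ->
   (f s).@[fun j => z 0 j] * (f0 t).@[fun j => z 0 j] =
   (f t).@[fun j => z 0 j] * (f0 s).@[fun j => z 0 j].
  by move=> zU; have := plucker_cross (fP z zU) (f0P z zU) s t.
have [t ft] := fnz _ yU; have [t' f0t'] := f0nz _ yU.
(* Proportional nonzero vectors have the same nonzero coordinates, so one index serves both
   representations. *)
have f0t : (f0 t).@[w] != 0.
  have := mulf_neq0 ft f0t'; rewrite cross //.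
  by apply: contraNneq => e; rewrite -/w e mulr0.
(* The comparison on the line is one-sided, so it is applied in both directions. *)
apply/eqP; rewrite eqn_leq; apply/andP; split.
  apply: (@line_degree_le _ _ v w _ f f0) => //.
  - by move=> a; have [s] := fnz _ (lineU a); exists s; rewrite -lineE.
  - by exists t.
  - by move=> a i j; rewrite /= -!lineE cross.
apply: (@line_degree_le _ _ v w _ f0 f) => //.
- by move=> a; have [s] := f0nz _ (lineU a); exists s; rewrite -lineE.
- by exists t.
- by move=> a i j; rewrite /= -!lineE mulrC -cross // mulrC.
Qed.
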